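(* Let $\mathcal{U}\subset\mathbb{R}^m$ be a set of states and let $\bm{v},\bm{f}:\mathcal{U}\to\mathbb{R}^n$ and $F:\mathcal{U}\to\mathbb{R}$ be arbitrary functions ($\bm{v}$ and $F$ are not assumed to be derived from an entropy). Let $\bm{f}_{\rm avg}:\mathcal{U}\times\mathcal{U}\to\mathbb{R}^n$ be consistent and symmetric, i.e. $\bm{f}_{\rm avg}(\bm{u},\bm{u})=\bm{f}(\bm{u})$ and $\bm{f}_{\rm avg}(\bm{u}_L,\bm{u}_R)=\bm{f}_{\rm avg}(\bm{u}_R,\bm{u}_L)$ for all states. Define $F_{\rm avg}:\mathcal{U}\times\mathcal{U}\to\mathbb{R}$ by $$F_{\rm avg}=\{\!\{F\}\!\}+\{\!\{\bm{v}\}\!\}\cdot\bm{f}_{\rm avg}-\{\!\{\bm{v}\cdot\bm{f}\}\!\}.$$ For states $\bm{u}_{i-1},\bm{u}_i,\bm{u}_{i+1}\in\mathcal{U}$ write $\bm{v}_i=\bm{v}(\bm{u}_i)$, $\bm{f}_{i+1/2}=\bm{f}_{\rm avg}(\bm{u}_i,\bm{u}_{i+1})$, $\bm{f}_{i-1/2}=\bm{f}_{\rm avg}(\bm{u}_{i-1},\bm{u}_i)$, $F_{i+1/2}=F_{\rm avg}(\bm{u}_i,\bm{u}_{i+1})$ and $F_{i-1/2}=F_{\rm avg}(\bm{u}_{i-1},\bm{u}_i)$. Then $$\bm{v}_i\cdot\left(\bm{f}_{i+1/2}-\bm{f}_{i-1/2}\right)=F_{i+1/2}-F_{i-1/2}\qquad\text{for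 all }\bm{u}_{i-1},\bm{u}_i,\bm{u}_{i+1}\in\mathcal{U}$$ if and only if $$[\![\bm{v}]\!]\cdot\bm{f}_{\rm avg}(\bm{u}_L,\bm{u}_R)=[\![\bm{v}\cdot\bm{f}-F]\!]\qquad\text{for all }\bm{u}_L,\bm{u}_R\in\mathcal{U}.$$
   Context: For a quantity $a$ depending on the state and a pair of states $(\bm{u}_L,\bm{u}_R)$, with $a_L=a(\bm{u}_L)$ and $a_R=a(\bm{u}_R)$, the average and jump are $\{\!\{a\}\!\}=\frac12(a_L+a_R)$ and $[\![a]\!]=a_L-a_R$. In particular $\{\!\{\bm{v}\cdot\bm{f}\}\!\}=\frac12(\bm{v}(\bm{u}_L)\cdot\bm{f}(\bm{u}_L)+\bm{v}(\bm{u}_R)\cdot\bm{f}(\bm{u}_R))$ and $[\![\bm{v}\cdot\bm{f}-F]\!]=(\bm{v}(\bm{u}_L)\cdot\bm{f}(\bm{u}_L)-F(\bm{u}_L))-(\bm{v}(\bm{u}_R)\cdot\bm{f}(\bm{u}_R)-F(\bm{u}_R))$. The dot denotes the Euclidean inner product on $\mathbb{R}^n$. *)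

(* Defs.v *)
From HB Require Import structures.
From mathcomp Require Import all_boot all_order all_algebra.
From mathcomp Require Import boolp classical_sets reals.

Set Implicit Arguments.
Unset Strict Implicit.
Unset Printing Implicit Defensive.

Import Order.TTheory GRing.Theory Num.Theory.
Local Open Scope ring_scope.

Definition dotv (R : realType) (n : nat) (x y : 'rV[R]_n) : R :=
  \sum_(j < n) x 0 j * y 0 j.

(* Averages and jumps are taken of a state-dependent quantity [a : S -> V];
   scalar quantities use [V := R^o]. *)
Definition avg (R : realType) (S : Type) (V : lmodType R) (a : S -> V)
    (uL uR : S) : V :=
  2^-1 *: (a uL + a uR).

(* The jump is left minus right. *)
Definition jump (S : Type) (V : zmodType) (a : S -> V) (uL uR : S) : V :=
  a uL - a uR.

Definition Favg (R : realType) (n : nat) (S : Type) (v f : S -> 'rV[R]_n)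
    (F : S -> R) (favg : S -> S -> 'rV[R]_n) (uL uR : S) : R :=
  avg (F : S -> R^o) uL uR + dotv (avg v uL uR) (favg uL uR)
  - avg ((fun u => dotv (v u) (f u)) : S -> R^o) uL uR.

(* Main.v *)
Require Import Defs.
From HB Require Import structures.
From mathcomp Require Import all_boot all_order all_algebra.
From mathcomp Require Import boolp classical_sets reals.
From mathcomp Require Import lra.

Set Implicit Arguments.
Unset Strict Implicit.
Unset Printing Implicit Defensive.

Import Order.TTheory GRing.Theory Num.Theory.
Local Open Scope ring_scope.

(** Put [psi u = v u . f u - F u], and let the defect of a pair be
    [D uL uR = [[v]] . favg uL uR - [[psi]]], so that the two-point condition
    says [D = 0].  Since [{{v}} = v uL - [[v]]/2 = v uR + [[v]]/2], the formula
    for [Favg] rearranges to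
      [v uL . favg - Favg = psi uL + D/2] and
      [v uR . favg - Favg = psi uR - D/2]
    (lemmas [flux_potential_left] and [flux_potential_right]).  The cell [ui] is
    the left state of the interface [i+1/2] and the right state of the interface
    [i-1/2], so in the difference of the two interfaces [psi ui] cancels, and
    the discrete chain rule at [ui] fails by exactly
    [(D ui uip1 + D uim1 ui)/2] (lemma [chain_rule_residual]).
    If [D = 0] this vanishes.  Conversely, jumps vanish on the diagonal, so
    [D u u = 0], and choosing [uim1 = ui] isolates [D ui uip1]. *)

Lemma dotvDl (R : realType) (n : nat) (x y z : 'rV[R]_n) :
  dotv (x + y) z = dotv x z + dotv y z.
Proof.
by rewrite /dotv -big_split; apply: eq_bigr => j _; rewrite mxE mulrDl.
Qed.

Lemma dotvZl (R : realType) (n : nat) (a : R) (x y : 'rV[R]_n) :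
  dotv (a *: x) y = a * dotv x y.
Proof.
by rewrite /dotv mulr_sumr; apply: eq_bigr => j _; rewrite mxE mulrA.
Qed.

Lemma dotvBl (R : realType) (n : nat) (x y z : 'rV[R]_n) :
  dotv (x - y) z = dotv x z - dotv y z.
Proof. by rewrite dotvDl -scaleN1r dotvZl mulN1r. Qed.

Lemma dotvBr (R : realType) (n : nat) (x y z : 'rV[R]_n) :
  dotv x (y - z) = dotv x y - dotv x z.
Proof.
by rewrite /dotv -sumrB; apply: eq_bigr => j _; rewrite !mxE mulrBr.
Qed.

Section Defect.

Variables (R : realType) (n : nat) (S : Type).
Variables (v f : S -> 'rV[R]_n) (F : S -> R) (favg : S -> S -> 'rV[R]_n).

(** The entropy flux potential, when [v] and [F] come from an entropy. *)
Definition potential (u : S) : R := dotv (v u) (f u) - F u.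

Definition defect (uL uR : S) : R :=
  dotv (jump v uL uR) (favg uL uR) - jump potential uL uR.

Lemma defect_diag (u : S) : defect u u = 0.
Proof. by rewrite /defect /jump dotvBl !subrr. Qed.

(** Replace [{{v}}] by [v uL - [[v]]/2] and likewise [{{psi}}] by
    [psi uL - [[psi]]/2]: the two half jumps combine into half the defect. *)
Lemma flux_potential_left (uL uR : S) :
  dotv (v uL) (favg uL uR) - Favg v f F favg uL uR =
  potential uL + 2^-1 * defect uL uR.
Proof.
rewrite /defect /Favg /jump /avg /potential dotvZl dotvDl dotvBl.
rewrite /GRing.scale /=; lra.
Qed.

(** The same expansion about the right state, where both half jumps change
    sign. *)
Lemma flux_potential_right (uL uR : S) :
  dotv (v uR) (favg uL uR) - Favg v f F favg uL uR =
  potential uR - 2^-1 * defect uL uR.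
Proof.
rewrite /defect /Favg /jump /avg /potential dotvZl dotvDl dotvBl.
rewrite /GRing.scale /=; lra.
Qed.

(** Both interface expansions are taken about the common state [ui], so
    [potential ui] drops out; the opposite signs of the half defects turn the
    difference of the interface terms into a sum of defects. *)
Lemma chain_rule_residual (uim1 ui uip1 : S) :
  dotv (v ui) (favg ui uip1 - favg uim1 ui)
  - (Favg v f F favg ui uip1 - Favg v f F favg uim1 ui) =
  2^-1 * (defect ui uip1 + defect uim1 ui).
Proof.
have := flux_potential_left ui uip1.
have := flux_potential_right uim1 ui.
rewrite dotvBr; lra.
Qed.

End Defect.

Theorem lemma1 (R : realType) (m n : nat) (U : set 'rV[R]_m)
    (v f : U -> 'rV[R]_n) (F : U -> R)
    (favg : U -> U -> 'rV[R]_n)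
    (favg_consistent : forall u : U, favg u u = f u)
    (favg_symmetric : forall uL uR : U, favg uL uR = favg uR uL) :
  (forall uim1 ui uip1 : U,
      dotv (v ui) (favg ui uip1 - favg uim1 ui) =
      Favg v f F favg ui uip1 - Favg v f F favg uim1 ui)
  <->
  (forall uL uR : U,
      dotv (jump v uL uR) (favg uL uR) =
      jump (fun u => dotv (v u) (f u) - F u) uL uR).
Proof.
split=> [chain_rule uL uR | two_point uim1 ui uip1]; apply/subr0_eq.
  rewrite -[LHS]/(defect v f F favg uL uR).
  (* A repeated left state makes the second defect a diagonal one. *)
  have := chain_rule_residual v f F favg uL uL uR.
  rewrite chain_rule subrr defect_diag; lra.
have defect0 uL uR : defect v f F favg uL uR = 0.
  by rewrite /defect two_point subrr.
by rewrite chain_rule_residual !defect0 addr0 mulr0.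
Qed.
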